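(* Let $M\in\mathbb{R}^{(n+1)\times(n+1)}$ be a matrix of the form $$M=\begin{bmatrix}A & v \\ v^T & \alpha\end{bmatrix},$$ where $A\in\mathbb{R}^{n\times n}$ is symmetric positive definite (respectively symmetric negative definite), $v\in\mathbb{R}^n$ and $\alpha\in\mathbb{R}$. Then $M$ has $n$ strictly positive (respectively strictly negative) eigenvalues, counted with multiplicity, and the sign (positive, negative or zero) of the remaining $(n+1)$-th eigenvalue is the same as the sign of $\alpha-v^TA^{-1}v$. *)

(* Defs.v *)
From mathcomp Require Import all_boot all_order all_algebra.
From mathcomp Require Import reals.

Set Implicit Arguments.
Unset Strict Implicit.
Unset Printing Implicit Defensive.

Import Order.TTheory GRing.Theory Num.Theory.
Local Open Scope ring_scope.

Definition posdefmx (R : realType) (n : nat) (A : 'M[R]_n) : Prop :=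
  A \is symmetricmx /\
  forall x : 'cV[R]_n, x != 0 -> 0 < (x^T *m A *m x) 0 0.

Definition negdefmx (R : realType) (n : nat) (A : 'M[R]_n) : Prop :=
  A \is symmetricmx /\
  forall x : 'cV[R]_n, x != 0 -> (x^T *m A *m x) 0 0 < 0.

(* [s] lists all the eigenvalues of [M] with algebraic multiplicity, in some
   order. Such an [s] is unique up to permutation; its existence entails that
   all the complex eigenvalues of [M] are real. *)
Definition eigenvalues_of (R : realType) (m : nat) (M : 'M[R]_m) (s : seq R)
    : Prop :=
  char_poly M = \prod_(x <- s) ('X - x%:P).

(* Main.v *)
(* Diagonalize M over R[i] in an orthonormal basis of eigenvectors. A
   two-dimensional span of eigenvectors meets the hyperplane where the last
   coordinate vanishes, and there the form of M is that of A, which is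
   definite; hence at most one eigenvalue of M lacks the sign of A. The sign of
   the remaining eigenvalue mu is read off the determinant:
   det M = det A * (alpha - v^T A^-1 v) is also mu times the product of the
   other n eigenvalues, which has the sign of det A. The positive and negative
   definite cases are treated together, as "c * A is positive definite" with
   c = 1 or c = -1. *)
Require Import Defs.
From mathcomp Require Import all_boot all_order all_algebra.
From mathcomp Require Import reals complex.

Set Implicit Arguments.
Unset Strict Implicit.
Unset Printing Implicit Defensive.

Import Order.TTheory GRing.Theory Num.Theory.
Local Open Scope ring_scope.
Local Open Scope sesquilinear_scope.

(** The rows of [spectralmx H] are orthonormal eigenvectors of [H], and [x] holds the coordinates of
    [u] in that basis; the Hermitian form is diagonal in these coordinates. *)
Lemma spectral_form (C : numClosedFieldType) (m : nat) (H : 'M[C]_m)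
    (x : 'rV[C]_m) (hH : H \is normalmx) (u := x *m spectralmx H) :
  (u *m H *m u ^t*) 0 0 = \sum_k spectral_diag H 0 k * `|x 0 k| ^+ 2.
Proof.
have /unitarymxP PP := spectral_unitarymx H.
have -> : u *m H *m u ^t* = x *m diag_mx (spectral_diag H) *m x ^t*.
  rewrite {1}(orthomx_spectralP hH) /u trmx_mul map_mxM !mulmxA.
  rewrite mulmxK ?spectral_unit //.
  by rewrite -(mulmxA _ (spectralmx H) (_ ^t*)) PP mulmx1.
rewrite mxE; apply: eq_bigr => k _.
rewrite mul_mx_diag !mxE normCK mulrAC mulrA.
by rewrite [_ * x 0 k]mulrC mulrAC.
Qed.

Lemma char_poly_spectral (C : numClosedFieldType) (m : nat) (H : 'M[C]_m) :
  H \is normalmx ->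
  char_poly H = \prod_k ('X - (spectral_diag H 0 k)%:P).
Proof.
move=> hH; set P := spectralmx H; set D := diag_mx (spectral_diag H).
have uP : P \in unitmx by apply: spectral_unit.
have PP : map_mx polyC (invmx P) *m map_mx polyC P = 1%:M.
  by rewrite -map_mxM mulVmx // map_mx1.
have -> : char_poly H = char_poly D.
  (* Scalar matrices commute with [P], so conjugating by [P] carries one characteristic matrix to
     the other. *)
  rewrite {1}(orthomx_spectralP hH) /char_poly /char_poly_mx.
  have -> : 'X%:M - map_mx polyC (invmx P *m D *m P) =
      map_mx polyC (invmx P) *m ('X%:M - map_mx polyC D) *m map_mx polyC P.
    rewrite !map_mxM mulmxBr mulmxBl; congr (_ - _).
    by rewrite -mulmxA -scalar_mxC mulmxA PP mul1mx.
  by rewrite !det_mulmx mulrAC -det_mulmx PP det1 mul1r.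
by rewrite char_poly_trig ?diag_mx_is_trig //; apply: eq_bigr => i _;
  rewrite mxE eqxx mulr1n.
Qed.

(* Two distinct such indices would give a nonzero combination of the
   corresponding eigenvectors with vanishing last coordinate, on which
   [c * H] is both positive and nonpositive. *)
Lemma spectral_diag_inj_npos (C : numClosedFieldType) (n : nat)
    (H : 'M[C]_(n + 1)) (hH : H \is normalmx) (c : C)
    (hpos : forall u : 'rV[C]_n, u != 0 ->
      0 < c * (row_mx u 0 *m H *m (row_mx u 0) ^t*) 0 0) (i j : 'I_(n + 1)) :
  c * spectral_diag H 0 i <= 0 -> c * spectral_diag H 0 j <= 0 -> i = j.
Proof.
move=> hi hj; apply/eqP; apply: contraT => ij.
set P := spectralmx H; pose l : 'I_(n + 1) := rshift n ord0.
have [x x0 [xk xl]] : exists2 x : 'rV[C]_(n + 1), x != 0 &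
    (forall k, k != i -> k != j -> x 0 k = 0) /\ (x *m P) 0 l = 0.
  (* The last coordinate always cancels in [P j l] times eigenvector [i] minus [P i l] times
     eigenvector [j], but this combination is sure to be nonzero only when [P j l] is. Otherwise
     eigenvector [j] alone serves. *)
  have [Pj0|Pj0] := eqVneq (P j l) 0.
    exists (delta_mx 0 j); last split.
    - by apply/rowV0Pn; exists (delta_mx 0 j); rewrite ?submx_refl //;
        apply/eqP=> /matrixP/(_ 0 j)/eqP; rewrite !mxE !eqxx oner_eq0.
    - by move=> k _ /negbTE kj; rewrite mxE kj.
    - by rewrite -rowE mxE.
  exists (P j l *: delta_mx 0 i - P i l *: delta_mx 0 j); last split.
  - apply/eqP=> /matrixP/(_ 0 i)/eqP.
    by rewrite !mxE !eqxx (negbTE ij) mulr0 subr0 mulr1 (negbTE Pj0).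
  - by move=> k /negbTE ki /negbTE kj; rewrite !mxE ki kj !mulr0 subrr.
  - by rewrite mulmxBl -!scalemxAl -!rowE !mxE mulrC subrr.
pose u := lsubmx (x *m P).
have xPE : x *m P = row_mx u 0.
  rewrite -[LHS]hsubmxK; congr row_mx; apply/matrixP=> a b.
  by rewrite !ord1 !mxE -[RHS]xl mxE.
have u0 : u != 0.
  apply: contraNneq x0 => u0; move: xPE; rewrite u0 row_mx0 => xP0.
  by rewrite -(mulmxK (spectral_unit H) x) xP0 mul0mx.
have := hpos u u0; rewrite -xPE spectral_form // mulr_sumr.
rewrite le_gtF // sumr_le0 // => k _.
rewrite mulrA; have [->|ki] := eqVneq k i; first by rewrite mulr_le0_ge0 ?exprn_ge0.
have [->|kj] := eqVneq k j; first by rewrite mulr_le0_ge0 ?exprn_ge0.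
by rewrite xk // normr0 expr0n mulr0.
Qed.

(** Compare constant coefficients: each side carries a factor [(-1) ^+ m], and multiplying by it
    once more cancels both. *)
Lemma det_char_poly_roots (R : comNzRingType) (m : nat) (M : 'M[R]_m)
    (e : 'I_m -> R) :
  char_poly M = \prod_k ('X - (e k)%:P) -> \det M = \prod_k e k.
Proof.
move=> eM; have := char_poly_det M; rewrite eM -horner_coef0 horner_prod.
under eq_bigr => k _ do rewrite !hornerE.
rewrite prodrN card_ord => /(congr1 ( *%R ((-1) ^+ m))).
by rewrite !mulrA -!exprD addnn -mul2n exprM sqrrN !expr1n !mul1r.
Qed.

Lemma det_block_schur (F : fieldType) (n p : nat) (A : 'M[F]_n)
    (B : 'M[F]_(n, p)) (C : 'M[F]_(p, n)) (D : 'M[F]_p) :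
  A \in unitmx ->
  \det (block_mx A B C D) = \det A * \det (D - C *m invmx A *m B).
Proof.
move=> uA; rewrite -(det_ublock A B).
(* Block Gaussian elimination: the left factor has determinant 1 and clears the block [C]. *)
have <- : \det (block_mx 1%:M 0 (- (C *m invmx A)) 1%:M *m block_mx A B C D) =
    \det (block_mx A B C D) by rewrite det_mulmx det_lblock !det1 !mul1r.
rewrite mulmx_block !mul1mx !mul0mx !addr0 !mulNmx mulmxKV // addNr.
by rewrite [- _ + D]addrC.
Qed.

Section RealSymmetric.
Variable R : rcfType.
Local Notation toC := (map_mx (real_complex R)).

Lemma symmetricmxP (m : nat) (M : 'M[R]_m) :
  reflect (M^T = M) (M \is symmetricmx).
Proof.
by rewrite is_hermitianmxE expr0 scale1r map_mx_id // eq_sym; apply: eqP.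
Qed.

Lemma toC_normal (m : nat) (M : 'M[R]_m) :
  M \is symmetricmx -> toC M \is normalmx.
Proof.
move=> /symmetricmxP MT; apply/hermitian_normalmx/is_hermitianmxP.
rewrite expr0 scale1r -{1}MT; apply/matrixP=> i j; rewrite !mxE.
by rewrite conj_Creal // complex_real.
Qed.

Lemma toC_spectral_diag_real (m : nat) (M : 'M[R]_m) :
  M \is symmetricmx ->
  exists e : 'I_m -> R, forall k, spectral_diag (toC M) 0 k = (e k)%:C%C.
Proof.
move=> /symmetricmxP MT.
have hM : toC M \is hermsymmx.
  apply/is_hermitianmxP; rewrite expr0 scale1r -{1}MT.
  by apply/matrixP=> i j; rewrite !mxE conj_Creal // complex_real.
exists (fun k => complex.Re (spectral_diag (toC M) 0 k)) => k.
by rewrite RRe_real //; apply/mxOverP/hermitian_spectral_diag_real.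
Qed.

(** Split [u] as [a + i b] with [a], [b] real. The cross terms cancel by symmetry of [A], leaving
    the sum of the real forms at [a] and [b], which are not both zero. *)
Lemma toC_form_gt0 (n : nat) (A : 'M[R]_n) (c : R)
    (hA : A \is symmetricmx)
    (hpos : forall x : 'cV[R]_n, x != 0 -> 0 < c * (x^T *m A *m x) 0 0)
    (u : 'rV[R[i]%C]_n) :
  u != 0 -> 0 < c%:C%C * (u *m toC A *m u ^t*) 0 0.
Proof.
move=> u0; pose a := map_mx (@complex.Re R) u; pose b := map_mx (@complex.Im R) u.
have uE : u = toC a + 'i%C *: toC b.
  by apply/matrixP=> i j; rewrite !mxE -complexE.
have utE : u ^t* = toC a^T - 'i%C *: toC b^T.
  apply/matrixP=> i j; rewrite !mxE; case: (u j i) => x y.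
  by rewrite -[Num.conj _]/(x -i* y)%C; simpc.
(* Both sides are 1 by 1 matrices, hence equal to their own transposes. *)
have ba : b *m A *m a^T = a *m A *m b^T.
  have <- : (b *m A *m a^T)^T = a *m A *m b^T.
    by rewrite !trmx_mul trmxK (symmetricmxP _ hA) mulmxA.
  by apply/matrixP=> i j; rewrite !ord1 [RHS]mxE.
have -> : u *m toC A *m u ^t* = toC (a *m A *m a^T + b *m A *m b^T).
  rewrite utE {1}uE !(mulmxDl, mulmxBr, mulmxDr) -!scalemxAl -!scalemxAr.
  rewrite -!map_mxM ba.
  rewrite scalerA -expr2 sqr_i scaleN1r opprD opprK map_mxD addrACA.
  by rewrite addrA subrK.
rewrite mxE -rmorphM ltcR mxE mulrDr.
have ge0 (x : 'rV[R]_n) : 0 <= c * (x *m A *m x^T) 0 0.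
  have [->|x0] := eqVneq x 0; first by rewrite !mul0mx mxE mulr0.
  by rewrite -{1}[x]trmxK ltW // hpos // trmx_eq0.
have gt0 (x : 'rV[R]_n) : x != 0 -> 0 < c * (x *m A *m x^T) 0 0.
  by move=> x0; rewrite -{1}[x]trmxK hpos // trmx_eq0.
have [a0|a0] := eqVneq a 0; last by rewrite ltr_pwDl ?gt0 ?ge0.
rewrite ltr_wpDl ?ge0 ?gt0 //; apply: contraNneq u0 => b0.
by rewrite uE a0 b0 !map_mx0 scaler0 addr0.
Qed.
Lemma char_poly_symmetric (m : nat) (M : 'M[R]_m) (e : 'I_m -> R) :
  M \is symmetricmx ->
  (forall k, spectral_diag (toC M) 0 k = (e k)%:C%C) ->
  char_poly M = \prod_k ('X - (e k)%:P).
Proof.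
move=> hM eE; apply: (map_poly_inj (real_complex R)).
rewrite map_char_poly char_poly_spectral ?toC_normal // rmorph_prod.
by apply: eq_bigr => k _; rewrite rmorphB /= map_polyX map_polyC /= eE.
Qed.

(** The quantity is the product of the [c * e k], and each of these is the value of [c] times the
    form at a unit eigenvector. *)
Lemma definite_det_gt0 (n : nat) (A : 'M[R]_n) (c : R) :
  A \is symmetricmx ->
  (forall x : 'cV[R]_n, x != 0 -> 0 < c * (x^T *m A *m x) 0 0) ->
  0 < c ^+ n * \det A.
Proof.
move=> hA hpos; have [e eE] := toC_spectral_diag_real hA.
rewrite (det_char_poly_roots (char_poly_symmetric hA eE)).
rewrite -[n in c ^+ n]card_ord -prodr_const -big_split /=.
apply: prodr_gt0 => k _; set P := spectralmx (toC A).
pose x : 'rV[R[i]%C]_n := delta_mx 0 k.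
have x0 : x != 0.
  by apply/eqP=> /matrixP/(_ 0 k)/eqP; rewrite !mxE !eqxx oner_eq0.
have xP0 : x *m P != 0.
  apply: contraNneq x0 => xP0.
  by rewrite -(mulmxK (spectral_unit (toC A)) x) xP0 mul0mx.
have := toC_form_gt0 hA hpos xP0.
rewrite spectral_form ?toC_normal // (bigD1 k) //= big1 => [|j /negbTE jk].
  by rewrite !mxE !eqxx normr1 expr1n mulr1 addr0 eE -rmorphM ltcR.
by rewrite !mxE jk andbF normr0 expr0n mulr0.
Qed.

Lemma bordered_eigenvalues (n : nat) (A : 'M[R]_n) (v : 'cV[R]_n)
    (alpha c : R) (M := block_mx A v v^T alpha%:M : 'M[R]_(n + 1)) :
  A \is symmetricmx ->
  (forall x : 'cV[R]_n, x != 0 -> 0 < c * (x^T *m A *m x) 0 0) ->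
  exists (s : n.-tuple R) (mu : R),
    [/\ char_poly M = \prod_(x <- rcons s mu) ('X - x%:P),
        forall i, 0 < c * tnth s i
      & Num.sg mu = Num.sg (alpha - (v^T *m invmx A *m v) 0 0)].
Proof.
move=> hA hpos; have AT := symmetricmxP _ hA.
have hM : M \is symmetricmx.
  by apply/symmetricmxP; rewrite tr_block_mx AT trmxK tr_scalar_mx.
have [e eE] := toC_spectral_diag_real hM.
have chM := char_poly_symmetric hM eE.
have hMpos (u : 'rV[R[i]%C]_n) : u != 0 ->
    0 < c%:C%C * (row_mx u 0 *m toC M *m (row_mx u 0) ^t*) 0 0.
  move=> u0; rewrite /M map_block_mx tr_row_mx map_col_mx mul_row_block.
  rewrite mul_row_col !mul0mx !addr0 trmx0 map_mx0 mulmx0 addr0.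
  exact: toC_form_gt0.
have uniq_npos i j : c * e i <= 0 -> c * e j <= 0 -> i = j.
  move=> hi hj; apply: (spectral_diag_inj_npos (toC_normal hM) hMpos);
    by rewrite eE -rmorphM lecR.
(* If every [c * e k] is positive, any index may be singled out as the remaining one; the last is
   taken. *)
have [i0 he] : exists i0, forall k, k != i0 -> 0 < c * e k.
  have [i0 hi0|pos] := pickP (fun k => c * e k <= 0).
    exists i0 => k; apply: contraNT; rewrite -leNgt => hk.
    by rewrite (uniq_npos k i0).
  by exists (rshift n ord0) => k _; rewrite ltNge pos.
have size_s : size [seq e k | k <- enum (predC1 i0)] == n.
  by rewrite size_map -cardE cardC1 card_ord addn1.
exists (Tuple size_s), (e i0).
have s_gt0 x : x \in Tuple size_s -> 0 < c * x.
  by move=> /mapP[k]; rewrite mem_enum => ki ->; apply: he.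
split.
- by rewrite big_rcons /= big_map big_enum /= mulrC chM (bigD1 i0).
- by move=> i; apply/s_gt0/mem_tnth.
have detM : \det M = e i0 * \prod_(k | k != i0) e k.
  by rewrite (det_char_poly_roots chM) (bigD1 i0).
have cA := definite_det_gt0 hA hpos.
have cs : 0 < c ^+ n * \prod_(k | k != i0) e k.
  (* Exactly [n] indices differ from [i0], so one factor [c] goes to each eigenvalue in the
     product. *)
  rewrite -[n in c ^+ n](_ : #|predC1 i0| = n); last first.
    by rewrite cardC1 card_ord addn1.
  by rewrite -prodr_const -big_split; apply: prodr_gt0.
have uA : A \in unitmx.
  by rewrite unitmxE unitfE; apply: contraTneq cA => ->; rewrite mulr0 ltxx.
have schur : \det M = \det A * (alpha - (v^T *m invmx A *m v) 0 0).
  by rewrite det_block_schur // det_mx11 !mxE eqxx mulr1n.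
have sgMp p x : 0 < p -> Num.sg (p * x) = Num.sg x :> R.
  by move=> p0; rewrite sgrM gtr0_sg // mul1r.
(* Scaling each side by its positive factor, [cs] or [cA], turns both arguments of the sign into
   [c ^+ n * \det M]. *)
rewrite -[LHS](sgMp _ _ cs) -[RHS](sgMp _ _ cA).
by rewrite -!mulrA -schur detM [e i0 * _]mulrC.
Qed.
End RealSymmetric.

Unset Implicit Arguments.

Theorem lemma5 (R : realType) (n : nat) (M : 'M[R]_(n + 1))
    (A : 'M[R]_n) (v : 'cV[R]_n) (alpha : R)
    (hM : M = block_mx A v v^T alpha%:M) :
  (posdefmx A ->
     exists (s : n.-tuple R) (mu : R),
       [/\ eigenvalues_of M (rcons s mu),
           forall i : 'I_n, 0 < tnth s i
         & Num.sg mu = Num.sg (alpha - (v^T *m invmx A *m v) 0 0)])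
  /\
  (negdefmx A ->
     exists (s : n.-tuple R) (mu : R),
       [/\ eigenvalues_of M (rcons s mu),
           forall i : 'I_n, tnth s i < 0
         & Num.sg mu = Num.sg (alpha - (v^T *m invmx A *m v) 0 0)]).
Proof.
rewrite hM; split=> -[hA hpos].
  have [x x0|s [mu [hs sgt hmu]]] := @bordered_eigenvalues R n A v alpha 1 hA.
    by rewrite mul1r hpos.
  by exists s, mu; split=> // i; rewrite -[tnth s i]mul1r.
have [x x0|s [mu [hs sgt hmu]]] := @bordered_eigenvalues R n A v alpha (-1) hA.
  by rewrite mulN1r oppr_gt0 hpos.
by exists s, mu; split=> // i; rewrite -oppr_gt0 -mulN1r.
Qed.
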